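(* Let $G=\langle\alpha\rangle\oplus\langle\beta\rangle$ be the (internal) direct sum of cyclic groups, where $\alpha$ has order $m$ and $\beta$ has order $n$ (both finite). Then the interchange laws belonging to $\Sigma(G;\alpha,\beta)$ form a basis for $\Sigma(G;\alpha,\beta)$ iff $m$ and $n$ are not both multiples of $6$.
   Context: For a multiplicative abelian group $G$ generated by $\alpha$ and $\beta$, $\Sigma(G;\alpha,\beta)$ is the set of groupoid identities satisfied in the integral group ring $\mathbb{Z}[G]$ when the binary operation is $xy=\alpha x+\beta y$. A groupoid term is linear if no variable occurs in it more than once; if $p$ is a linear term and $q$ is obtained from $p$ by swapping two of its variables, then $p=q$ is an interchange law. A basis is a set of identities whose equational consequences are exactly $\Sigma(G;\alpha,\beta)$. *)

(* Defs.v *)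
From HB Require Import structures.
From mathcomp Require Import all_boot all_order all_algebra all_fingroup.
Set Implicit Arguments. Unset Strict Implicit. Unset Printing Implicit Defensive.
Import GRing.Theory.

Inductive term : Type := Var of nat | App of term & term.

Fixpoint eval (T : Type) (op : T -> T -> T) (e : nat -> T) (t : term) : T :=
  match t with
  | Var i => e i
  | App t1 t2 => op (eval op e t1) (eval op e t2)
  end.

Fixpoint vars (t : term) : seq nat :=
  match t with Var i => [:: i] | App t1 t2 => vars t1 ++ vars t2 end.

Definition linear_term (t : term) : bool := uniq (vars t).

Fixpoint rename (f : nat -> nat) (t : term) : term :=
  match t with Var i => Var (f i) | App t1 t2 => App (rename f t1) (rename f t2) end.

Definition swapv (i j k : nat) : nat :=
  if k == i then j else if k == j then i else k.

Definition interchange (p q : term) : Prop :=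
  linear_term p /\
  exists i j, [/\ i \in vars p, j \in vars p, i != j & q = rename (swapv i j) p].

Fixpoint subst (s : nat -> term) (t : term) : term :=
  match t with Var i => s i | App t1 t2 => App (subst s t1) (subst s t2) end.

Inductive consequence (E : term -> term -> Prop) : term -> term -> Prop :=
| cons_ax p q (s : nat -> term) : E p q -> consequence E (subst s p) (subst s q)
| cons_refl p : consequence E p p
| cons_sym p q : consequence E p q -> consequence E q p
| cons_trans p q r : consequence E p q -> consequence E q r -> consequence E p r
| cons_app p1 p2 q1 q2 : consequence E p1 q1 -> consequence E p2 q2 ->
    consequence E (App p1 p2) (App q1 q2).

Definition is_basis (E Sigma : term -> term -> Prop) : Prop :=
  forall p q, consequence E p q <-> Sigma p q.

(* Integral group ring Z[G] of a finite group G = [set: gT]: formal sums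
   sum_h x(h) h, represented by coefficient functions.  The groupoid
   operation is x y = a x + b y; coefficient of h in a x is x(a^-1 h). *)
Definition gr_op (gT : finGroupType) (a b : gT)
    (x y : {ffun gT -> int}) : {ffun gT -> int} :=
  [ffun h => (x (a^-1 * h)%g + y (b^-1 * h)%g)%R].

Definition Sigma (gT : finGroupType) (a b : gT) (p q : term) : Prop :=
  forall e : nat -> {ffun gT -> int}, eval (gr_op a b) e p = eval (gr_op a b) e q.

Definition interchange_laws (gT : finGroupType) (a b : gT) (p q : term) : Prop :=
  interchange p q /\ Sigma a b p q.

(* Main.v *)
Require Import Defs.
From mathcomp Require Import all_boot all_order all_algebra all_fingroup.
From mathcomp Require Import all_solvable all_field.
From mathcomp Require Import ring zify.
Set Implicit Arguments. Unset Strict Implicit. Unset Printing Implicit Defensive.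
Import Order.TTheory GRing.Theory Num.Theory.

(** Give the root of a term the type 1 and the left and right child of a node of
    type g the types a^-1 g and b^-1 g: an identity lies in [Sigma] iff each
    variable occurs equally often at leaves of each type on both sides.

    If v counts internal nodes by type, then (1 - a - b) v is determined by the
    numbers of leaves.  Roots of unity with z + w = 1 are primitive sixth roots, so
    1 - a - b is a non-zero-divisor unless 6 divides both orders; the leaves then
    determine v.  Two terms with the same typed leaves and the same v are joined by
    exchanges of disjoint subterms of equal type, that is, by interchange laws:
    match the terms from the root downwards; when the roots of two corresponding
    subterms differ and one of them is a leaf, the required kind of node occurs at
    the same type in another unmatched subterm.

    Interchange laws preserve v.  If 6 divides both orders, the 6-periodic sequence
    0, 1, 1, 0, -1, -1, evaluated at i - j on a^i b^j, is annihilated by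
    1 - a - b; grafting an internal node at the types with value 1, respectively
    -1, of a term with leaves of every type gives an identity of [Sigma] that
    changes v. *)

(** * Roots of unity whose sum is 1 *)

Section RootsOfUnity.
Local Open Scope ring_scope.

(** The relation gives [z ^+ 3 = -1], so only [m %% 6] matters. Each nonzero remainder would make a
    positive integer vanish, against characteristic zero. *)
Lemma hexagon_dvd6 (R : numDomainType) (z : R) (m : nat) :
  z ^+ 2 = z - 1 -> z ^+ m = 1 -> (6 %| m)%N.
Proof.
move=> z2 zm.
have z3 : z ^+ 3 = -1 by rewrite exprS z2 mulrBr -expr2 z2; ring.
have z6 : z ^+ 6 = 1 by rewrite -[6%N]/(3 * 2)%N exprM z3 sqrrN expr1n.
have n0 k (x y : R) : x = y -> x - y != k.+1%:R.
  by move=> ->; rewrite subrr eq_sym pnatr_eq0.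
move: zm; rewrite {1}(divn_eq m 6) mulnC exprD exprM z6 expr1n mul1r /dvdn.
have := ltn_pmod m (isT : (0 < 6)%N).
case: (m %% 6)%N => [|[|[|[|[|[|//]]]]]] _ // zr; exfalso.
- rewrite expr1 in zr.
  by have /negP[] := n0 0%N _ _ z2; apply/eqP; rewrite zr; ring.
- have z2' : z = 2%:R by rewrite -[z](subrK 1) -z2 zr -natr1.
  by have /negP[] := n0 2 _ _ zr; apply/eqP; rewrite z2'; ring.
- by have /negP[] := n0 1%N _ _ (esym zr); apply/eqP; rewrite z3; ring.
- have z1 : z = -1 by rewrite -zr exprS z3; ring.
  by have /negP[] := n0 2%N _ _ z2; apply/eqP; rewrite z1; ring.
- have z1 : z = 1 by rewrite -z6 exprS zr mulr1.
  by have /negP[] := n0 0%N _ _ z2; apply/eqP; rewrite z1; ring.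
Qed.

(* |z| = |1 - z| = 1 forces z + z^* = 1 and hence z (1 - z) = 1. *)
Lemma unity_root_sum1 (F : numClosedFieldType) (z : F) (m n : nat) :
  (0 < m)%N -> (0 < n)%N -> z ^+ m = 1 -> (1 - z) ^+ n = 1 -> z ^+ 2 = z - 1.
Proof.
move=> m0 n0 zm zn.
have unit_norm (x : F) k : (0 < k)%N -> x ^+ k = 1 -> x * x^* = 1.
  move=> k0 xk; rewrite -normCK; suff -> : `|x| = 1 by rewrite expr1n.
  apply/eqP; rewrite -(@pexpr_eq1 _ _ k) //; first by rewrite -normrX xk normr1.
have := unit_norm _ _ m0 zm; have := unit_norm _ _ n0 zn.
rewrite rmorphB rmorph1 => h1 h2.
have h3 : z^* = 1 - z.
  have: (1 - z) * (1 - z^*) = 1 - z - z^* + z * z^* by ring.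
  rewrite h1 h2 => h; apply/eqP; rewrite -subr_eq0; apply/eqP.
  have -> : z^* - (1 - z) = 1 - (1 - z - z^* + 1) by ring.
  by rewrite -h subrr.
have -> : z ^+ 2 = z - z * z^* by rewrite h3; ring.
by rewrite h2.
Qed.

(** A common root [z] satisfies [z ^+ 2 = z - 1], and then so does [1 - z]; thus 6 divides both
    exponents. *)
Lemma coprimep_unity_sum1 (F : numClosedFieldType) (m n : nat) :
  (0 < m)%N -> (0 < n)%N -> ~~ ((6 %| m) && (6 %| n))%N ->
  coprimep ('X^m - 1 : {poly F}) ((1 - 'X) ^+ n - 1).
Proof.
move=> m0 n0 no6; apply/Pdiv.ClosedField.coprimepP => z.
rewrite /root !hornerE subr_eq0 => /eqP zm.
apply: contraNneq no6; rewrite ?hornerE => /eqP; rewrite subr_eq0 => /eqP zn.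
have z2 := unity_root_sum1 m0 n0 zm zn.
rewrite (hexagon_dvd6 z2 zm) (hexagon_dvd6 _ zn) //.
by rewrite sqrrB z2; ring.
Qed.

End RootsOfUnity.

(** * Injectivity of 1 - a - b *)

Section Injectivity.
Variables (gT : finGroupType) (F : numClosedFieldType).
Local Open Scope ring_scope.

(** The action of [F[X]] on functions on the group in which ['X] translates the argument by [a]. *)
Definition shift_poly (a : gT) (k : gT -> F) (P : {poly F}) (h : gT) : F :=
  \sum_(i < size P) P`_i * k (a ^+ i * h)%g.

Lemma shift_poly_wide a k (P : {poly F}) h N : (size P <= N)%N ->
  shift_poly a k P h = \sum_(i < N) P`_i * k (a ^+ i * h)%g.
Proof.
move=> sN; rewrite /shift_poly (big_ord_widen N (fun i => P`_i * k (a ^+ i * h)%g)) //.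
rewrite big_mkcond; apply: eq_bigr => i _; case: ltnP => // le.
by rewrite nth_default ?mul0r.
Qed.

Lemma shift_polyB a k P Q h :
  shift_poly a k (P - Q) h = shift_poly a k P h - shift_poly a k Q h.
Proof.
pose N := maxn (size P) (size Q).
rewrite !(@shift_poly_wide _ _ _ _ N) ?leq_maxl ?leq_maxr //; last first.
  by rewrite (leq_trans (size_polyD _ _)) // size_polyN.
by rewrite -sumrB; apply: eq_bigr => i _; rewrite coefB mulrBl.
Qed.

Lemma shift_polyX a k P h :
  shift_poly a k ('X * P) h = shift_poly a k P (a * h)%g.
Proof.
rewrite mulrC (@shift_poly_wide _ _ _ _ (size P).+1); last first.
  by rewrite (leq_trans (size_polyMleq _ _)) // size_polyX addn2.
rewrite big_ord_recl coefMX mul0r add0r; apply: eq_bigr => i _.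
by rewrite coefMX /= expgSr mulgA.
Qed.

Lemma shift_poly1 a k h : shift_poly a k 1 h = k h.
Proof. by rewrite /shift_poly size_poly1 big_ord1 coef1 mul1r expg0 mul1g. Qed.

(* On the kernel of 1 - a - b one has b = 1 - a, so it is killed by both
   [X^m - 1] and [(1 - X)^n - 1], which are coprime. *)
Lemma kernel_eq0 (a b : gT) (k : gT -> F) :
  commute a b -> ~~ ((6 %| #[a]%g) && (6 %| #[b]%g))%N ->
  (forall h, k h = k (a * h)%g + k (b * h)%g) -> forall h, k h = 0.
Proof.
move=> cab no6 kE h.
have XE P n x : shift_poly a k ('X^n * P) x = shift_poly a k P (a ^+ n * x)%g.
  elim: n x => [|n IH] x; first by rewrite mul1r mul1g.
  by rewrite exprS -mulrA shift_polyX IH expgSr mulgA.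
have bE P x : shift_poly a k ((1 - 'X) * P) x = shift_poly a k P (b * x)%g.
  rewrite mulrBl mul1r shift_polyB shift_polyX -sumrB; apply: eq_bigr => i _.
  rewrite -mulrBr; congr (_ * _); rewrite kE !mulgA -expgS -expgSr.
  by rewrite (commuteX i (commute_sym cab)) addrAC subrr add0r.
have bnE P n x :
    shift_poly a k ((1 - 'X) ^+ n * P) x = shift_poly a k P (b ^+ n * x)%g.
  elim: n x => [|n IH] x; first by rewrite mul1r mul1g.
  by rewrite exprS -mulrA bE IH expgSr mulgA.
have /coprimep_unity_sum1 := no6.
move=> /(_ F (order_gt0 a) (order_gt0 b)) /Bezout_eq1_coprimepP[[u v] /= uv].
rewrite -(shift_poly1 a k) -uv.
have -> P Q : P + Q = P - (0 - Q) :> {poly F} by ring.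
have k0 x : shift_poly a k 0 x = 0 by rewrite /shift_poly size_poly0 big_ord0.
rewrite !shift_polyB k0 ![_ * (_ - 1)]mulrC !mulrBl !mul1r !shift_polyB.
by rewrite XE bnE !expg_order !mul1g !subrr.
Qed.

End Injectivity.

(** * Typed terms and substitution *)

Section Trees.
Variables (gT : finGroupType) (a b : gT).

(* Nodes of a term with root type [g] carry types in [gT]; following [gr_op],
   the children of a node of type [g] have types [a^-1 g] and [b^-1 g].  A node
   is of kind [None] if internal and [Some x] if it is the leaf [Var x]. *)
Fixpoint weight (w : option nat -> gT -> nat) (t : term) (g : gT) : nat :=
  match t with
  | Var x => w (Some x) g
  | App l r => w None g + (weight w l (a^-1 * g)%g + weight w r (b^-1 * g)%g)
  end.

Fixpoint leaves (t : term) (g : gT) : seq (nat * gT) :=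
  match t with
  | Var x => [:: (x, g)]
  | App l r => leaves l (a^-1 * g)%g ++ leaves r (b^-1 * g)%g
  end.

Definition kind (t : term) : option nat := if t is Var x then Some x else None.

Fixpoint occurs (k : option nat) (h : gT) (t : term) (g : gT) : bool :=
  (kind t == k) && (g == h) ||
  if t is App l r then occurs k h l (a^-1 * g)%g || occurs k h r (b^-1 * g)%g
  else false.

Definition upd (s : nat -> term) (j : nat) (t : term) (i : nat) : term :=
  if i == j then t else s i.

Lemma vars_leaves t g : vars t = unzip1 (leaves t g).
Proof. by elim: t g => //= l IHl r IHr g; rewrite /unzip1 map_cat -!/(unzip1 _) -IHl -IHr. Qed.

(** Types arise from the root type by left multiplications, which commute with right ones. This
    reduces any root type to 1. *)
Lemma leavesM t g h : leaves t (g * h)%g = [seq (x.1, x.2 * h)%g | x <- leaves t g].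
Proof.
elim: t g => //= l IHl r IHr g.
by rewrite !mulgA IHl IHr map_cat.
Qed.

Lemma leaves_subst s t g :
  leaves (subst s t) g = flatten [seq leaves (s x.1) x.2 | x <- leaves t g].
Proof.
elim: t g => [x|l IHl r IHr] g /=; first by rewrite cats0.
by rewrite IHl IHr map_cat flatten_cat.
Qed.

Lemma subst_subst s1 s2 t : subst s2 (subst s1 t) = subst (fun x => subst s2 (s1 x)) t.
Proof. by elim: t => //= l -> r ->. Qed.

Lemma subst_rename s f t : subst s (rename f t) = subst (s \o f) t.
Proof. by elim: t => //= l -> r ->. Qed.

Lemma eq_subst s1 s2 t : {in vars t, s1 =1 s2} -> subst s1 t = subst s2 t.
Proof.
elim: t => [x|l IHl r IHr] eqs /=; first by apply: eqs; rewrite inE.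
by rewrite IHl ?IHr // => x xv; apply: eqs; rewrite mem_cat xv ?orbT.
Qed.

Lemma eval_subst (T : Type) (op : T -> T -> T) e s t :
  eval op e (subst s t) = eval op (fun x => eval op e (s x)) t.
Proof. by elim: t => //= l -> r ->. Qed.

Lemma eval_rename (T : Type) (op : T -> T -> T) e f t :
  eval op e (rename f t) = eval op (e \o f) t.
Proof. by elim: t => //= l -> r ->. Qed.

(** The operation is arbitrary: [gr_op] gives soundness, and [shift_op] below separates the two
    hexagonal trees. *)
Lemma consequence_sound (T : Type) (op : T -> T -> T) (E : term -> term -> Prop) :
  (forall p q, E p q -> forall e, eval op e p = eval op e q) ->
  forall p q, consequence E p q -> forall e, eval op e p = eval op e q.
Proof.
move=> Eop p q; elim=> {p q} [p q s /Eop pq|//|p q _ IH|p q r _ IH1 _ IH2|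
  p1 p2 q1 q2 _ IH1 _ IH2] e //=.
- by rewrite !eval_subst.
- by rewrite IH1.
- by rewrite IH1 IH2.
Qed.

Lemma eval_gr_op e t g : eval (gr_op a b) e t g = (\sum_(x <- leaves t g) e x.1 x.2)%R.
Proof.
elim: t g => [x|l IHl r IHr] g /=; first by rewrite big_seq1.
by rewrite ffunE IHl IHr big_cat.
Qed.

Lemma occurs_weight k h t g :
  occurs k h t g = (0 < weight (fun k' h' => (k' == k) && (h' == h)) t g).
Proof.
elim: t g => [x|l IHl r IHr] g /=; first by rewrite orbF lt0b.
by rewrite !addn_gt0 IHl IHr lt0b.
Qed.

(** * Exchanging subterms of equal type *)

Notation laws := (interchange_laws a b).

Lemma swapv_eqr i j : swapv i j j = i.
Proof. by rewrite /swapv eqxx; case: eqP. Qed.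

Lemma swapv_id i j k : k != i -> k != j -> swapv i j k = k.
Proof. by rewrite /swapv => /negPf-> /negPf->. Qed.

(** Swapping two variables at the same type keeps the typed leaves, up to order. *)
Lemma swap_law D i j h R : linear_term D ->
  perm_eq (leaves D 1) [:: (i, h), (j, h) & R] ->
  laws D (rename (swapv i j) D).
Proof.
move=> linD pD.
have pv : perm_eq (vars D) [:: i, j & unzip1 R].
  by rewrite (vars_leaves D 1); apply: (perm_map fst pD).
have := linD; rewrite /linear_term (perm_uniq pv) /= inE negb_or.
case/and3P=> /andP[nij niR] njR _.
split.
  split=> //; exists i, j.
  by rewrite !(perm_mem pv) !inE !eqxx nij ?orbT.
move=> e; apply/ffunP => g; rewrite eval_rename !eval_gr_op.
rewrite -[g]mul1g leavesM !big_map !(perm_big _ pD) !big_cons /= swapv_eqr.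
rewrite {1}/swapv eqxx addrCA; congr (_ + (_ + _))%R.
apply: eq_big_seq => x xR /=.
have xn : x.1 \in unzip1 R by apply: map_f.
by rewrite swapv_id //; [apply: contraNneq niR => <-|apply: contraNneq njR => <-].
Qed.

(** [C] is a context whose variables are holes filled by a substitution. Splitting moves the root of
    an internal filling of [j] into the context, with [n] as a fresh second hole. *)
Definition split_at (C : term) (j n : nat) : term :=
  subst (upd Var j (App (Var j) (Var n))) C.

Lemma leaves_split_at C j n h R : linear_term C -> n \notin vars C ->
  perm_eq (leaves C 1) ((j, h) :: R) ->
  perm_eq (leaves (split_at C j n) 1)
    [:: (j, a^-1 * h)%g, (n, b^-1 * h)%g & R].
Proof.
move=> linC nC pC.
have := linC; rewrite /linear_term (vars_leaves C 1) (perm_uniq (perm_map fst pC)).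
case/andP=> /= jR _.
rewrite leaves_subst (permPl (perm_flatten (perm_map _ pC))) /= {1}/upd eqxx /=.
rewrite !perm_cons.
suff -> : [seq leaves (upd Var j (App (Var j) (Var n)) x.1) x.2 | x <- R] =
          [seq [:: x] | x <- R] by rewrite flatten_seq1.
apply/eq_in_map => -[x g] xR; rewrite /upd /=; case: eqP => //= xj.
by case/negP: jR; rewrite -xj; apply: (map_f fst xR).
Qed.

Lemma linear_split_at C j n h R : linear_term C -> n \notin vars C ->
  perm_eq (leaves C 1) ((j, h) :: R) -> linear_term (split_at C j n).
Proof.
move=> linC nC pC; have := leaves_split_at linC nC pC.
move=> /(perm_map fst) pS.
have pv := perm_map fst pC.
rewrite /linear_term (vars_leaves _ 1) (perm_uniq pS) /=.
have := linC; rewrite /linear_term (vars_leaves C 1) (perm_uniq pv) /=.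
case/andP=> jR ->; move: nC; rewrite (vars_leaves C 1) (perm_mem pv) inE negb_or.
by case/andP=> nj nR; rewrite inE negb_or eq_sym nj jR nR.
Qed.

Lemma subst_split_at s C j n :
  subst s (split_at C j n) = subst (upd s j (App (s j) (s n))) C.
Proof.
rewrite subst_subst; apply: eq_subst => x _; rewrite /upd.
by case: (x == j).
Qed.

Lemma subst_split_upd s C j n l r : s j = App l r -> n \notin vars C -> n != j ->
  subst s C = subst (upd (upd s j l) n r) (split_at C j n).
Proof.
move=> sj nC nj; rewrite subst_split_at; apply: eq_subst => x xC.
rewrite /upd eqxx [j == n]eq_sym (negPf nj) eqxx.
case: (eqVneq x j) => [->//|_]; rewrite ifN //.
by apply: contraNneq nC => <-.
Qed.

Lemma fresh_var (s : seq nat) : exists n, n \notin s.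
Proof.
exists (foldr maxn 0 s).+1; apply/negP => ns.
have: forall x, x \in s -> x <= foldr maxn 0 s.
  elim: s {ns} => //= y s IH x; rewrite inE leq_max => /orP[/eqP->|/IH->].
    by rewrite leqnn.
  by rewrite orbT.
by move/(_ _ ns); rewrite ltnn.
Qed.

Lemma leaves_uniq C i h R : linear_term C ->
  perm_eq (leaves C 1) ((i, h) :: R) -> (i \notin unzip1 R) && uniq (unzip1 R).
Proof.
by move=> + pC; rewrite /linear_term (vars_leaves C 1) (perm_uniq (perm_map fst pC)).
Qed.

(* [s2] arises from [s] by exchanging [s i] with a subterm of kind [k] of [s j]
   which has the same type [h] as the variable [i] of the linear term [C]. *)
Definition swap_result k C s i h j h' (R : seq (nat * gT)) s2 : Prop :=
  [/\ {in unzip1 R, s2 =1 s}, kind (s2 i) = k,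
    forall w, weight w (s2 i) h + weight w (s2 j) h' =
              weight w (s i) h + weight w (s j) h' &
    consequence laws (subst s C) (subst s2 C)].

Lemma swap_here C s i h j R : linear_term C ->
  perm_eq (leaves C 1) [:: (i, h), (j, h) & R] ->
  swap_result (kind (s j)) C s i h j h R (s \o swapv i j).
Proof.
move=> linC pC.
have /andP[] := leaves_uniq linC pC; rewrite /= inE negb_or.
case/andP=> nij niR /andP[njR _]; split=> /=.
- move=> x xR /=; rewrite swapv_id //; first by apply: contraNneq niR => <-.
  by apply: contraNneq njR => <-.
- by rewrite /swapv eqxx.
- by move=> w; rewrite swapv_eqr {1}/swapv eqxx addnC.
- by rewrite -subst_rename; apply: cons_ax; apply: swap_law pC.
Qed.

(* To reach a deeper subterm of [s j], move one level of it into [C]. *)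
Lemma swap_subterm k C s i h j h' R : linear_term C ->
  perm_eq (leaves C 1) [:: (i, h), (j, h') & R] -> occurs k h (s j) h' ->
  exists s2, swap_result k C s i h j h' R s2.
Proof.
move: {2}(s j) (erefl (s j)) => t.
elim: t C s i h j h' R => [x|l IHl r IHr] C s i h j h' R sj linC pC.
  rewrite sj /= orbF => /andP[/eqP xk /eqP hh]; rewrite hh in pC *.
  by exists (s \o swapv i j); rewrite -xk -[Some x]/(kind (Var x)) -sj; apply: swap_here.
rewrite sj /= => /or3P[/andP[/eqP xk /eqP hh]|ol|or].
- rewrite hh in pC *; exists (s \o swapv i j).
  by rewrite -xk -[None]/(kind (App l r)) -sj; apply: swap_here.
all: have [n nC] := fresh_var (vars C).
all: have /andP[] := leaves_uniq linC pC; rewrite /= inE negb_or;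
  case/andP=> nij niR /andP[njR _].
all: have pC' : perm_eq (leaves C 1) [:: (j, h'), (i, h) & R] by
  rewrite (permPl pC) -[[:: _, _ & _]]/([:: _] ++ [:: _] ++ _) perm_catCA.
all: have linS := linear_split_at linC nC pC'; have pS := leaves_split_at linC nC pC'.
all: pose s1 := upd (upd s j l) n r.
all: have := nC; rewrite (vars_leaves C 1) (perm_mem (perm_map fst pC)) !inE /=;
  rewrite !negb_or => /and3P[ni nj nR].
all: have s1j : s1 j = l by rewrite /s1 /upd eqxx eq_sym (negPf nj).
all: have s1n : s1 n = r by rewrite /s1 /upd eqxx.
all: have s1i : s1 i = s i by rewrite /s1 /upd (negPf nij) eq_sym (negPf ni).
all: have s1R : {in unzip1 R, s1 =1 s} by
  move=> x xR; rewrite /s1 /upd ifN; [rewrite ifN //; apply: contraNneq njR => <-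
    | apply: contraNneq nR => <-].
all: have sC := subst_split_upd sj nC nj; rewrite -/s1 in sC.
- have [||s2 [s2R s2k s2w s2c]] :=
    IHl (split_at C j n) s1 i h j (a^-1 * h')%g ((n, (b^-1 * h')%g) :: R) s1j linS.
  + rewrite (permPl pS) -[[:: _, _, _ & _]]/([:: _; _] ++ [:: _] ++ _).
    by rewrite perm_catCA /=.
  + by rewrite s1j.
  (* Undo the split: the root is put back over the two fillings. *)
  exists (upd s2 j (App (s2 j) (s2 n))).
  have s2n : s2 n = r by rewrite s2R // inE eqxx.
  split.
  + move=> x xR; rewrite /upd ifN; last by apply: contraNneq njR => <-.
    by rewrite s2R ?s1R // inE xR orbT.
  + by rewrite /upd (negPf nij).
  + move=> w; rewrite {1}/upd (negPf nij) /upd eqxx sj /= s2n.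
    by move: (s2w w); rewrite s1j s1i; clear; lia.
  + by rewrite -subst_split_at sC.
- have [||s2 [s2R s2k s2w s2c]] :=
    IHr (split_at C j n) s1 i h n (b^-1 * h')%g ((j, (a^-1 * h')%g) :: R) s1n linS.
  + rewrite (permPl pS) -[[:: _, _, _ & _]]/([:: _; _] ++ [:: _] ++ _).
    rewrite perm_catCA /= perm_cons.
    by rewrite -[[:: _, _ & _]]/([:: _] ++ [:: _] ++ _) perm_catCA.
  + by rewrite s1n.
  exists (upd s2 j (App (s2 j) (s2 n))).
  have s2j : s2 j = l by rewrite s2R // inE eqxx.
  split.
  + move=> x xR; rewrite /upd ifN; last by apply: contraNneq njR => <-.
    by rewrite s2R ?s1R // inE xR orbT.
  + by rewrite /upd (negPf nij).
  + move=> w; rewrite {1}/upd (negPf nij) /upd eqxx sj /= s2j.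
    by move: (s2w w); rewrite s1n s1i; clear; lia.
  + by rewrite -subst_split_at sC.
Qed.

(** * Matching two terms from the root *)

Lemma weight_gt0 t g : 0 < weight (fun _ _ => 1) t g.
Proof. by case: t. Qed.

Lemma occurs_root t g : occurs (kind t) g t g.
Proof. by case: t => [x|l r] /=; rewrite !eqxx. Qed.

(** Equal weights give as many nodes of kind [k] and type [h] on both sides. The root of [s' i] is
    one; [s i] is a leaf of another kind ([kind (s i)] is coerced to a boolean), so some filling in
    [F] contains one. *)
Lemma align C i h F R s s' : linear_term C ->
  perm_eq (leaves C 1) ((i, h) :: F ++ R) ->
  (forall w, \sum_(x <- (i, h) :: F) weight w (s x.1) x.2 =
             \sum_(x <- (i, h) :: F) weight w (s' x.1) x.2) ->
  kind (s i) -> kind (s i) != kind (s' i) ->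
  exists s2, [/\ {in unzip1 R, s2 =1 s}, kind (s2 i) = kind (s' i),
    forall w, \sum_(x <- (i, h) :: F) weight w (s2 x.1) x.2 =
              \sum_(x <- (i, h) :: F) weight w (s x.1) x.2 &
    consequence laws (subst s C) (subst s2 C)].
Proof.
set k := kind (s' i) => linC pC eqw si nk.
have /hasP[[j h'] xF] : has (fun x => occurs k h (s x.1) x.2) F.
  have /eq_has -> : (fun x => occurs k h (s x.1) x.2) =1
      fun x => true && (weight (fun k' h' => (k' == k) && (h' == h)) (s x.1) x.2 != 0).
    by move=> x; rewrite occurs_weight lt0n.
  rewrite -sum_nat_seq_neq0.
  have := eqw (fun k' h' => (k' == k) && (h' == h)).
  rewrite !big_cons => /(congr1 (leq 1)); rewrite /= !addn_gt0 -!occurs_weight.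
  rewrite occurs_root -lt0n; case: (s i) si nk => //= x _ /negPf->.
  by rewrite /= => ->.
rewrite /= => oj.
have pF := perm_to_rem xF.
have pC' : perm_eq (leaves C 1) [:: (i, h), (j, h') & rem (j, h') F ++ R].
  by rewrite (permPl pC) perm_cons -cat_cons perm_cat2r.
have [s2 [s2R s2k s2w s2c]] := swap_subterm linC pC' oj.
exists s2; split=> // [x xR|w]; first by rewrite s2R // /unzip1 map_cat mem_cat xR orbT.
rewrite !big_cons !(perm_big _ pF) !big_cons !addnA s2w; congr (_ + _).
by apply: eq_big_seq => x xF'; rewrite s2R // /unzip1 map_cat mem_cat map_f.
Qed.

(** [F] lists the holes still to be matched, [R] those already filled alike. Matching equal roots
    lowers the number of nodes bounded by [N]: equal leaves pass to [R], internal roots go into the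
    context. *)
Lemma forest_consequence N C F R s s' : linear_term C ->
  perm_eq (leaves C 1) (F ++ R) -> {in unzip1 R, s =1 s'} ->
  (forall w, \sum_(x <- F) weight w (s x.1) x.2 =
             \sum_(x <- F) weight w (s' x.1) x.2) ->
  \sum_(x <- F) weight (fun _ _ => 1) (s x.1) x.2 <= N ->
  consequence laws (subst s C) (subst s' C).
Proof.
elim: N C F R s s' => [|N IH] C [|[i h] F] R s s' linC pC eR eqw leN.
1,3: suff -> : subst s C = subst s' C by apply: cons_refl.
1,2: by apply: eq_subst => x; rewrite (vars_leaves C 1) (perm_mem (perm_map fst pC)) => /eR.
  by move: leN; rewrite big_cons leqNgt addn_gt0 weight_gt0.
have same_kind (s1 s2 : nat -> term) : {in unzip1 R, s1 =1 s2} ->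
    (forall w, \sum_(x <- (i, h) :: F) weight w (s1 x.1) x.2 =
               \sum_(x <- (i, h) :: F) weight w (s2 x.1) x.2) ->
    \sum_(x <- (i, h) :: F) weight (fun _ _ => 1) (s1 x.1) x.2 <= N.+1 ->
    kind (s1 i) = kind (s2 i) -> consequence laws (subst s1 C) (subst s2 C).
  move=> {s s' eR eqw leN} eR eqw leN.
  move: leN; rewrite big_cons => leN.
  case s1i: (s1 i) => [x|l r]; case s2i: (s2 i) => [y|l' r'] //=.
    move=> [xy]; apply: (IH C F ((i, h) :: R)) => //.
    - by rewrite (permPl pC) perm_sym -[_ :: R]/([:: (i, h)] ++ R) perm_catCA.
    - by move=> z; rewrite inE => /predU1P[->|/eR//]; rewrite s1i s2i xy.
    - by move=> w; move: (eqw w); rewrite !big_cons s1i s2i xy => /addnI.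
    - by move: leN; rewrite s1i.
  move=> _; have [n nC] := fresh_var (vars C).
  have /andP[iFR _] := leaves_uniq linC pC.
  have := nC; rewrite (vars_leaves C 1) (perm_mem (perm_map fst pC)) /= inE negb_or.
  case/andP=> ni nFR.
  rewrite (subst_split_upd s1i nC ni) (subst_split_upd s2i nC ni).
  have updE (t : nat -> term) u v x : x \in unzip1 (F ++ R) ->
      upd (upd t i u) n v x = t x.
    move=> xFR; rewrite /upd ifN; last by apply: contraNneq nFR => <-.
    by rewrite ifN //; apply: contraNneq iFR => <-.
  have sumE (t : nat -> term) u v w :
      \sum_(x <- [:: (i, a^-1 * h)%g, (n, b^-1 * h)%g & F])
         weight w (upd (upd t i u) n v x.1) x.2 =
      weight w u (a^-1 * h)%g + (weight w v (b^-1 * h)%g +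
         \sum_(x <- F) weight w (t x.1) x.2).
    have ti : upd (upd t i u) n v i = u by rewrite /upd eqxx eq_sym (negPf ni).
    have tn : upd (upd t i u) n v n = v by rewrite /upd eqxx.
    rewrite !big_cons /= ti tn; congr (_ + (_ + _)).
    apply: eq_big_seq => x xF.
    by rewrite updE // /unzip1 map_cat mem_cat map_f.
  apply: (IH _ [:: (i, a^-1 * h)%g, (n, b^-1 * h)%g & F] R).
  - exact: linear_split_at pC.
  - exact: leaves_split_at pC.
  - by move=> x xR; rewrite !updE ?eR // /unzip1 map_cat mem_cat xR orbT.
  - move=> w; rewrite !sumE.
    by move: (eqw w); rewrite !big_cons /= s1i s2i /= -!addnA => /addnI.
  - by move: leN; rewrite s1i sumE /= -!addnA add1n ltnS.
(* If the roots differ, one is a leaf; [align] rearranges that side, using symmetry when it is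
   [s']. *)
case: (eqVneq (kind (s i)) (kind (s' i))) => [/same_kind|nk]; first exact.
case ki: (kind (s i)) => [x|].
  have ki' : kind (s i) by rewrite ki.
  have [s2 [s2R s2k s2w s2c]] := align linC pC eqw ki' nk.
  apply: (cons_trans s2c); apply: same_kind => //.
  - by move=> y yR; rewrite s2R ?eR.
  - by move=> w; rewrite s2w.
  - by rewrite s2w.
have ki' : kind (s' i) by move: nk; rewrite ki; case: (kind (s' i)).
have eqw' w := esym (eqw w); rewrite eq_sym in nk.
have [s2 [s2R s2k s2w s2c]] := align linC pC eqw' ki' nk.
apply: (@cons_trans _ _ (subst s2 C)); last exact: cons_sym.
apply: same_kind => //.
- by move=> y yR; rewrite s2R ?eR.
- by move=> w; rewrite s2w.
Qed.

Lemma weight_consequence p q : (forall w, weight w p 1 = weight w q 1) ->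
  consequence laws p q.
Proof.
move=> eqw.
rewrite -[p]/(subst (fun _ => p) (Var 0)) -[q]/(subst (fun _ => q) (Var 0)).
apply: (@forest_consequence (weight (fun _ _ => 1) p 1) _ [:: (0, 1%g)] [::]) => //.
- by move=> w; rewrite !big_seq1.
- by rewrite big_seq1.
Qed.

(** * Recovering the internal nodes from the leaves *)

Definition leaf_part (w : option nat -> gT -> nat) (k : option nat) (h : gT) : nat :=
  if k is Some x then w k h else 0.

Definition internal_count (t : term) (g y : gT) : nat :=
  weight (fun k h => (k == None) && (h == y)) t g.

Lemma weight_split w t g : weight w t g =
  weight (leaf_part w) t g + \sum_y internal_count t g y * w None y.
Proof.
elim: t g => [x|l IHl r IHr] g /=.
  by rewrite big1 ?addn0.
rewrite IHl IHr /internal_count /=.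
under [in RHS]eq_bigr => y _ do rewrite !mulnDl.
rewrite !big_split /=.
have -> : \sum_y (g == y) * w None y = w None g.
  rewrite (bigD1 g) //= eqxx mul1n big1 ?addn0 // => y.
  by rewrite eq_sym => /negPf->.
by lia.
Qed.

(** With the weights of [x] as coefficients of the element assigned to [x], evaluation at 1 yields
    the leaf weight. *)
Lemma weight_leaf_Sigma w p q : Sigma a b p q ->
  weight (leaf_part w) p 1 = weight (leaf_part w) q 1.
Proof.
pose e x : {ffun gT -> int} := [ffun h => (w (Some x) h)%:Z%R].
have evalE t g : eval (gr_op a b) e t g = (weight (leaf_part w) t g)%:Z%R.
  elim: t g => [x|l IHl r IHr] g /=; first by rewrite ffunE.
  by rewrite ffunE IHl IHr add0n PoszD.
by move=> /(_ e)/ffunP/(_ 1%g); rewrite !evalE => -[].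
Qed.

(* Every node other than the root is a child of an internal node. *)
Lemma internal_count_children t g y :
  internal_count t g (a * y)%g + internal_count t g (b * y)%g + (g == y) =
  internal_count t g y + weight (leaf_part (fun _ h => h == y)) t g.
Proof.
rewrite /internal_count; elim: t g => [x|l IHl r IHr] g //=.
have := IHl (a^-1 * g)%g; have := IHr (b^-1 * g)%g.
rewrite !(can2_eq (mulKVg _) (mulKg _)) /= !add0n.
move: (nat_of_bool _) (nat_of_bool _) (nat_of_bool _) => ? ? ?.
by do 8!move: (weight _ _ _) => ?; lia.
Qed.

(** The leaf terms of [internal_count_children] cancel, so the difference of the counts lies in the
    kernel of 1 - a - b. *)
Lemma Sigma_internal_count p q : commute a b ->
  ~~ ((6 %| #[a]%g) && (6 %| #[b]%g)) -> Sigma a b p q ->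
  internal_count p 1 =1 internal_count q 1.
Proof.
move=> cab no6 Spq y; apply/eqP; rewrite -(eqr_nat algC) -subr_eq0; apply/eqP.
pose k y : algC := ((internal_count p 1 y)%:R - (internal_count q 1 y)%:R)%R.
apply: (kernel_eq0 (k := k) cab no6) => {}y; rewrite /k.
have := internal_count_children p 1 y; have := internal_count_children q 1 y.
rewrite (weight_leaf_Sigma _ Spq) => /(congr1 (GRing.natmul (1 : algC)%R)) h1.
move=> /(congr1 (GRing.natmul (1 : algC)%R)); move: h1; rewrite !natrD => /esym h1 /esym h2.
by rewrite (canRL (addrK _) h1) (canRL (addrK _) h2); ring.
Qed.

Lemma Sigma_consequence p q : commute a b ->
  ~~ ((6 %| #[a]%g) && (6 %| #[b]%g)) -> Sigma a b p q -> consequence laws p q.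
Proof.
move=> cab no6 Spq; apply: weight_consequence => w.
rewrite (weight_split w p) (weight_split w q) (weight_leaf_Sigma _ Spq); congr (_ + _).
by apply: eq_bigr => y _; rewrite (Sigma_internal_count cab no6 Spq).
Qed.

End Trees.

(** * A non-consequence when 6 divides both orders *)

Section Counterexample.
Variables (gT : finGroupType) (a b : gT).
Local Open Scope ring_scope.

Definition hex (n : nat) : int := nth 0 [:: 0; 1; 1; 0; -1; -1] (n %% 6).

Lemma hexD6 n k : (6 %| k)%N -> hex (n + k) = hex n.
Proof. by rewrite /hex -modnDmr => /eqP->; rewrite addn0. Qed.

Lemma hex_cases n : [\/ hex n = 0, hex n = 1 | hex n = -1].
Proof.
rewrite /hex; have := ltn_pmod n (isT : (0 < 6)%N).
by case: (n %% 6)%N => [|[|[|[|[|[|//]]]]]] _ /=;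
  (by constructor 1) || (by constructor 2) || (by constructor 3).
Qed.

(** Modulo 6, [n + 5] stands for n - 1, just as [i + 5 * j] stands for i - j below. The recurrence
    has characteristic polynomial X^2 - X + 1. *)
Lemma hex_rec n : hex (n + 5) + hex (n + 1) = hex n.
Proof.
rewrite /hex -modnDml -[((n + 1) %% 6)%N]modnDml.
have := ltn_pmod n (isT : (0 < 6)%N).
by case: (n %% 6)%N => [|[|[|[|[|[|//]]]]]] _ /=.
Qed.

(** Under a root of type h, the tooth [F j] has type a^-1 b^-j h; in [lcomb] it has type b^-1 a^-j
    h. *)
Fixpoint rcomb (F : nat -> term) (k : nat) : term :=
  if k is k'.+1 then App (F 0%N) (rcomb (fun j => F j.+1) k') else Var 0.

Fixpoint lcomb (F : nat -> term) (k : nat) : term :=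
  if k is k'.+1 then App (lcomb (fun j => F j.+1) k') (F 0%N) else Var 0.

Definition tip (c : bool) : term := if c then App (Var 0) (Var 0) else Var 0.

(* If the root has type [h], the [(i, j)] tip has type [a^-(i+1) b^-(j+1) h]. *)
Definition hex_tree (s : int) : term :=
  lcomb (fun i => rcomb (fun j => tip (hex (i + 5 * j) == s)) #[b]%g) #[a]%g.

(** Each internal node contributes an extra [c] at its type, so evaluation also records internal
    nodes. *)
Definition shift_op (c x y : {ffun gT -> int}) : {ffun gT -> int} :=
  [ffun h => gr_op a b x y h + c h].

Lemma shift_opE c x y h :
  shift_op c x y h = x (a^-1 * h)%g + y (b^-1 * h)%g + c h.
Proof. by rewrite !ffunE. Qed.

Lemma eval_shift_op c e t h :
  eval (shift_op c) e t h = eval (gr_op a b) e t h + eval (shift_op c) (fun=> 0) t h.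
Proof.
elim: t h => [x|l IHl r IHr] h /=; first by rewrite ffunE addr0.
by rewrite !shift_opE ffunE IHl IHr; ring.
Qed.

Lemma eval_shift_op0 e t : eval (shift_op 0) e t = eval (gr_op a b) e t.
Proof.
apply/ffunP => h; rewrite eval_shift_op; suff -> : eval (shift_op 0) (fun=> 0) t = 0.
  by rewrite ffunE addr0.
elim: t {h} => [x|l IHl r IHr] //=; apply/ffunP => h.
by rewrite shift_opE IHl IHr !ffunE !addr0.
Qed.

(** The contribution of [c] depends only on the shape of a term, which renaming preserves. *)
Lemma laws_shift_op c p q : interchange_laws a b p q ->
  forall e, eval (shift_op c) e p = eval (shift_op c) e q.
Proof.
case=> -[_ [i [j [_ _ _ ->]]]] Spq e; apply/ffunP => h.
rewrite eval_shift_op [RHS]eval_shift_op -Spq; congr (_ + _).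
by rewrite eval_rename.
Qed.

Lemma eval_rcombB c e F F' k h :
  eval (shift_op c) e (rcomb F k) h - eval (shift_op c) e (rcomb F' k) h =
  \sum_(j < k) (eval (shift_op c) e (F j) (a^-1 * (b^-1 ^+ j * h))%g -
                eval (shift_op c) e (F' j) (a^-1 * (b^-1 ^+ j * h))%g).
Proof.
elim: k F F' h => [|k IH] F F' h; first by rewrite big_ord0 subrr.
rewrite big_ord_recl /= !shift_opE mul1g.
under eq_bigr => j _ do rewrite /bump /= add1n expgSr -[(_ * _ * h)%g]mulgA.
by rewrite -(IH (fun j => F j.+1) (fun j => F' j.+1)); ring.
Qed.

Lemma eval_lcombB c e F F' k h :
  eval (shift_op c) e (lcomb F k) h - eval (shift_op c) e (lcomb F' k) h =
  \sum_(i < k) (eval (shift_op c) e (F i) (b^-1 * (a^-1 ^+ i * h))%g -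
                eval (shift_op c) e (F' i) (b^-1 * (a^-1 ^+ i * h))%g).
Proof.
elim: k F F' h => [|k IH] F F' h; first by rewrite big_ord0 subrr.
rewrite big_ord_recl /= !shift_opE mul1g.
under eq_bigr => j _ do rewrite /bump /= add1n expgSr -[(_ * _ * h)%g]mulgA.
by rewrite -(IH (fun j => F j.+1) (fun j => F' j.+1)); ring.
Qed.

Lemma eval_tipB c e n g :
  eval (shift_op c) e (tip (hex n == 1)) g -
  eval (shift_op c) e (tip (hex n == -1)) g =
  hex n * (e 0%N (a^-1 * g)%g + e 0%N (b^-1 * g)%g + c g - e 0%N g).
Proof.
by case: (hex_cases n) => ->; rewrite /= ?shift_opE; ring.
Qed.

Hypothesis cab : commute a b.

Lemma eval_hex_treeB c e h :
  let Q i j := (a^-1 ^+ i.+1 * b^-1 ^+ j.+1 * h)%g in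
  eval (shift_op c) e (hex_tree 1) h - eval (shift_op c) e (hex_tree (-1)) h =
  \sum_(i < #[a]%g) \sum_(j < #[b]%g) hex (i + 5 * j) *
    (e 0%N (Q i.+1 j) + e 0%N (Q i j.+1) + c (Q i j) - e 0%N (Q i j)).
Proof.
move=> Q.
have cab' : commute a^-1 b^-1 by apply/commuteV/commute_sym/commuteV/commute_sym.
rewrite /hex_tree eval_lcombB; apply: eq_bigr => i _.
rewrite eval_rcombB; apply: eq_bigr => j _; rewrite eval_tipB.
have -> : (a^-1 * (b^-1 ^+ j * (b^-1 * (a^-1 ^+ i * h))) = Q i j)%g.
  rewrite /Q !mulgA -[(_ * _ * b^-1)%g]mulgA -expgSr [(a^-1 ^+ i.+1)%g]expgS.
  rewrite -!mulgA; congr (_ * _)%g.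
  rewrite !mulgA; congr (_ * _)%g; exact/commuteX/commute_sym/commuteX.
have -> : (a^-1 * Q i j = Q i.+1 j)%g by rewrite /Q !mulgA -expgS.
suff -> : (b^-1 * Q i j = Q i j.+1)%g by [].
rewrite /Q [(b^-1 ^+ j.+2)%g]expgS !mulgA; congr (_ * _ * _)%g.
exact/commuteX/commute_sym.
Qed.

Lemma sum_cyclic_shift (f : nat -> int) n : f n = f 0%N ->
  \sum_(i < n) f i.+1 = \sum_(i < n) f i.
Proof.
move=> fn; apply: (addrI (f 0%N)).
by rewrite -(big_ord_recl n (fun i => f i)) big_ord_recr /= fn addrC.
Qed.

Hypotheses (a6 : (6 %| #[a]%g)%N) (b6 : (6 %| #[b]%g)%N).

(** Cyclic reindexing, allowed by the 6-periodicity of [hex], gives each [x i j] a coefficient that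
    vanishes by [hex_rec]. *)
Lemma Sigma_hex_tree : Sigma a b (hex_tree 1) (hex_tree (-1)).
Proof.
move=> e; apply/ffunP => h; apply/eqP; rewrite -subr_eq0 -!eval_shift_op0.
rewrite eval_hex_treeB; set Q := fun i j => (a^-1 ^+ i.+1 * b^-1 ^+ j.+1 * h)%g.
pose x i j : int := e 0%N (Q i j).
have Qa j : Q #[a]%g j = Q 0%N j by rewrite /Q (expgS a^-1) (expgVn a) expg_order invg1 mulg1.
have Qb i : Q i #[b]%g = Q i 0%N by rewrite /Q (expgS b^-1) (expgVn b) expg_order invg1 mulg1.
under eq_bigr => i _.
  under eq_bigr => j _ do rewrite ffunE addr0 mulrBr mulrDr.
  rewrite sumrB big_split /=; over.
rewrite sumrB big_split /= exchange_big /= -/x.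
have -> : \sum_(j < #[b]%g) \sum_(i < #[a]%g) hex (i + 5 * j) * x i.+1 j =
          \sum_(j < #[b]%g) \sum_(i < #[a]%g) hex (i + 5 * j + 5) * x i j.
  apply: eq_bigr => j _.
  rewrite -(@sum_cyclic_shift (fun i => hex (i + 5 * j + 5) * x i j)); last first.
    by rewrite /x Qa -addnA addnC hexD6.
  apply: eq_bigr => i _; congr (_ * _).
  (* Adding 6 turns i + 5j into (i + 1) + 5j + 5. *)
  by rewrite -[in LHS](@hexD6 _ 6) //; congr hex; lia.
have -> : \sum_(i < #[a]%g) \sum_(j < #[b]%g) hex (i + 5 * j) * x i j.+1 =
          \sum_(i < #[a]%g) \sum_(j < #[b]%g) hex (i + 5 * j + 1) * x i j.
  apply: eq_bigr => i _.
  rewrite -(@sum_cyclic_shift (fun j => hex (i + 5 * j + 1) * x i j)); last first.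
    by rewrite /x Qb addnAC hexD6 ?dvdn_mull // muln0 addn0.
  apply: eq_bigr => j _; rewrite /x; congr (_ * _).
  by rewrite -[in LHS](@hexD6 _ 6) //; congr hex; lia.
rewrite exchange_big /= -big_split -sumrB big1 // => i _.
rewrite -big_split -sumrB big1 // => j _ /=.
by rewrite -mulrDl hex_rec subrr.
Qed.

Lemma hex_tree_separated : (<[a]> :&: <[b]> = 1)%g ->
  ~ consequence (interchange_laws a b) (hex_tree 1) (hex_tree (-1)).
Proof.
move=> tiab; pose c : {ffun gT -> int} := [ffun g => (g == 1%g)%:R].
move=> /(consequence_sound (@laws_shift_op c)) /(_ (fun=> 0)) eqh.
have gt1 (k : nat) : (6 %| k -> 0 < k -> 1 < k)%N by case: k => [|[|k]].
have a1 := gt1 _ a6 (order_gt0 a); have b0 := order_gt0 b.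
(* This root type gives the tip (1, 0), where [hex] is 1, the type 1. It is the only such tip, so
   the difference is 1, while [eqh] makes it 0. *)
have /= := eval_hex_treeB c (fun=> 0) (a * a * b)%g.
have cE (i : 'I_#[a]%g) (j : 'I_#[b]%g) :
    c (a^-1 ^+ i.+1 * b^-1 ^+ j.+1 * (a * a * b))%g =
    ((i == Ordinal a1) && (j == Ordinal b0))%:R.
  rewrite ffunE; congr (nat_of_bool _)%:R.
  have -> : (a^-1 ^+ i.+1 * b^-1 ^+ j.+1 * (a * a * b) =
             (a ^+ i)^-1 * a * (b ^+ j)^-1)%g.
    have cb : commute (b^-1 ^+ j.+1)%g (a * a)%g.
      by apply/commute_sym/commuteX/commuteV/commute_sym/commuteM/commute_sym.
    rewrite -mulgA [(b^-1 ^+ j.+1 * _)%g]mulgA cb (expgSr b^-1) (expgSr a^-1).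
    by rewrite -!mulgA mulVg mulg1 mulKg !expgVn.
  apply/eqP/andP => [|[/eqP-> /eqP->]]; last first.
    by rewrite /= expg0 invg1 mulVg mulg1.
  move=> /eqP; rewrite -eq_mulgV1 => /eqP ij.
  (* The sum being direct, a^(1-i) = b^j forces both sides to be 1. *)
  have: (b ^+ j)%g \in (<[a]> :&: <[b]>)%g.
    by rewrite inE mem_cycle andbT -ij groupM ?groupV ?mem_cycle ?cycle_id.
  rewrite tiab => /set1gP bj.
  move: ij; rewrite bj => /eqP; rewrite -eq_invg_mul invgK => ai.
  split; apply/eqP/val_inj => /=.
    by have := eq_expg_mod_order a i 1; rewrite expg1 ai !modn_small // => /esym/eqP.
  have := eq_expg_mod_order b j 0; rewrite bj eqxx !modn_small // => /esym/eqP.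
  exact.
rewrite eqh subrr (bigD1 (Ordinal a1)) //= (bigD1 (Ordinal b0)) //=.
rewrite (cE (Ordinal a1) (Ordinal b0)) !eqxx !ffunE !big1 // => [i i1|j j0].
  by rewrite big1 // => j _; rewrite cE (negPf i1) !ffunE /=; ring.
by rewrite (cE (Ordinal a1)) (negPf j0) andbF !ffunE /=; ring.
Qed.

End Counterexample.

Theorem theorem9p2 (gT : finGroupType) (a b : gT) :
  (<[a]> \x <[b]>)%g = [set: gT] ->
  is_basis (interchange_laws a b) (Sigma a b) <->
  ~~ ((6 %| #[a]%g) && (6 %| #[b]%g)).
Proof.
case/dprodP=> _ _ /centsP cba tiab.
have cab : commute a b by apply/commute_sym/cba; apply: cycle_id.
split=> [basis | no6 p q].
  apply/negP => /andP[a6 b6]; apply: (hex_tree_separated cab a6 tiab).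
  by apply/basis/Sigma_hex_tree.
split; last exact: Sigma_consequence.
by move=> pq; apply: consequence_sound pq => p' q' [_ Spq].
Qed.
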